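(* For each $\beta>0$ there exists a constant $C(\beta)$, depending only on $\beta$, such that for all integers $n\ge 1$ (with $\lambda=1-\beta/\sqrt n>0$), $$\mathbb{E}\,\big|\sqrt{n}\,X_i\big|\le C(\beta),\quad i=1,2,\qquad\qquad \mathbb{E}\,\big|n X_i\big|\le C(\beta),\quad i\ge 3,$$ where $X=(X_i)_{i\ge1}$ is the stationary fluid-scaled state of the Join the Shortest Queue system with $n$ servers and arrival rate $n\lambda$.
   Context: Join the Shortest Queue (JSQ) model: there are $n$ identical servers, customers arrive according to a Poisson process with rate $n\lambda$, and service times are i.i.d. exponential with rate $1$. Each server has its own infinite buffer. An arriving customer enters service immediately at an idle server if one is available; otherwise the customer is routed to a server with the smallest number of customers in its buffer (ties broken arbitrarily). Customers do not switch servers. The Halfin-Whitt regime is assumed: $\lambda=1-\beta/\sqrt n$ with $\beta>0$ fixed. Let $Q_i(t)$ be the number of servers with $i$ or more customers at time $t$. Then $\{Q(t)=(Q_i(t))_{i\ge1}\}_{t\ge0}$ is a positive recurrent continuous-time Markov chain on $$S=\Big\{q\in\{0,1,\dots,n\}^{\infty} : q_i\ge q_{i+1}\text{ for } i\ge1,\ \sum_{i=1}^\infty q_i<\infty\Big\}.$$ Its transitions from state $q$ are: $q\to q+e^{(1)}$ at rate $n\lambda 1(q_1<n)$; $q\to q+e^{(i)}$ at rate $n\lambda 1(q_1=\dots=q_{i-1}=n,\ q_i<n)$ for $i\ge2$; $q\to q-e^{(i)}$ at rate $q_i-q_{i+1}$ for $i\ge1$. Here $e^{(i)}$ is the infinite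 vector with $i$th entry $1$ and all others $0$. Let $Q=(Q_i)_{i\ge1}$ have the stationary distribution of the chain and set $X_1=(Q_1-n)/n$ and $X_i=Q_i/n$ for $i\ge2$. *)

(* Defs.v *)
From HB Require Import structures.
From mathcomp Require Import all_boot all_order all_algebra.
From mathcomp Require Import all_classical all_reals all_analysis.
Set Implicit Arguments.
Unset Strict Implicit.
Unset Printing Implicit Defensive.
Import Order.TTheory GRing.Theory Num.Theory.
Import numFieldNormedType.Exports.

Local Open Scope classical_set_scope.
Local Open Scope ring_scope.

Section continuous_time_chains.
Context {R : realType} {E : choiceType}.
Implicit Types (S : set E) (P : R -> E -> E -> R).

Definition transition_function S P : Prop :=
  [/\ forall t x y, 0 <= t -> S x -> S y -> 0 <= P t x y,
      forall t x, 0 <= t -> S x -> (\esum_(y in S) (P t x y)%:E = 1)%E,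
      forall x y, S x -> S y -> P 0 x y = (x == y)%:R &
      forall s t x y, 0 <= s -> 0 <= t -> S x -> S y ->
        (\esum_(z in S) (P s x z * P t z y)%:E = (P (s + t) x y)%:E)%E].

(* The conservative Q-matrix with jump rates r off the diagonal; the values
   r x x are ignored. *)
Definition q_matrix S (r : E -> E -> R) (x y : E) : R :=
  if x == y then - fine (\esum_(z in S `\ x) (r x z)%:E)%E else r x y.

Definition has_q_matrix S P (G : E -> E -> R) : Prop :=
  forall x y, S x -> S y ->
    h^-1 * (P h x y - (x == y)%:R) @[h --> 0^'+] --> G x y.

Definition markov_chain_with_rates S (r : E -> E -> R) P : Prop :=
  transition_function S P /\ has_q_matrix S P (q_matrix S r).

Definition invariant_law S P (p : E -> \bar R) : Prop :=
  forall t y, 0 <= t -> S y -> (\esum_(x in S) (p x * (P t x y)%:E) = p y)%E.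

End continuous_time_chains.

(* A state q is stored as a function on nat whose value at i >= 1 is the number
   q_i of servers with at least i customers. Index 0 carries no information: it
   is set to n, the number of servers with at least 0 customers, so that q <= n
   follows from monotonicity. *)
Definition jsq_space (R : realType) (n : nat) : set (nat -> nat) :=
  [set q | [/\ q 0%N = n,
               forall i, (q i.+1 <= q i)%N &
               (\sum_(1 <= i <oo) (q i)%:R%:E < +oo :> \bar R)%E]].

Definition add_unit (i : nat) (q : nat -> nat) : nat -> nat :=
  fun j => (q j + (j == i))%N.

Definition sub_unit (i : nat) (q : nat -> nat) : nat -> nat :=
  fun j => (q j - (j == i))%N.

Definition arrival_rate (R : realType) (n : nat) (lambda : R)
    (q : nat -> nat) (i : nat) : R :=
  n%:R * lambda *
  `[< (forall j, (1 <= j < i)%N -> q j = n) /\ (q i < n)%N >]%:R.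

Definition departure_rate (R : realType) (q : nat -> nat) (i : nat) : R :=
  (q i)%:R - (q i.+1)%:R.

(* The truncated subtraction in sub_unit is harmless: on the state space,
   q i = 0 forces departure_rate q i = 0. *)
Definition jsq_rate (R : realType) (n : nat) (lambda : R)
    (q q' : nat -> nat) : R :=
  fine (\sum_(1 <= i <oo)
    (`[< q' = add_unit i q >]%:R * arrival_rate n lambda q i +
     `[< q' = sub_unit i q >]%:R * departure_rate R q i)%:E)%E.

Definition jsq_fluid (R : realType) (n : nat) (q : nat -> nat) (i : nat) : R :=
  (if i == 1%N then (q i)%:R - n%:R else (q i)%:R) / n%:R.

(* Main.v *)
Require Import Defs.
From HB Require Import structures.
From mathcomp Require Import all_boot all_order all_algebra.
From mathcomp Require Import all_classical all_reals all_analysis.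
From mathcomp Require Import measurable_realfun ring lra.
Set Implicit Arguments.
Unset Strict Implicit.
Unset Printing Implicit Defensive.
Import Order.TTheory GRing.Theory Num.Theory.
Import numFieldNormedType.Exports.
Local Open Scope classical_set_scope.
Local Open Scope ring_scope.

(* The jump rates of the chain are bounded, so E[G f(Q)] = 0 for its generator G
   and every bounded f. Write s = sqrt n, y = n - Q_1 for the number of idle
   servers and U = Q_2 - y. Linear test functions give E[y] <= beta s and
   E[Q_3] <= n lambda P(Q_2 = n). The drift of U is y - beta s, up to the term
   Q_3 - n lambda 1(Q_2 = n), so U^2 gives
     beta s E[Q_2] <= beta s E[y] + E[y Q_2] + n,
   and E[y Q_2] is controlled by y^2, because y drifts by beta s - y - Q_2 until
   it hits 0. One degree higher, y^2 Q_2, y^3 and U^3 give E[Q_2^2] = O(n);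
   finally E[Q_3] <= n P(Q_2 = n) <= E[Q_2^2] / n. The terms with Q_3 cost
   nothing: |U| <= n, with U = n when Q_2 = n, so for j = 1, 2
     E[U^j (Q_3 - n lambda 1(Q_2 = n))] <= n^j E[Q_3 - n lambda 1(Q_2 = n)] <= 0.
   All these test functions are bounded, as they involve finitely many Q_i. *)

(** * Expectations of functions of a discrete random element *)

Definition bounded_on (R : realType) (E : Type) (S : set E) (f : E -> R) : Prop :=
  exists K, forall x, S x -> `|f x| <= K.

Section bounded_on.
Context {R : realType} {E : Type} {S : set E}.
Implicit Types f g : E -> R.

Lemma bounded_on_cst (c : R) : bounded_on S (fun=> c).
Proof. by exists `|c|. Qed.

Lemma bounded_onD f g : bounded_on S f -> bounded_on S g ->
  bounded_on S (fun x => f x + g x).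
Proof.
move=> [K fK] [L gL]; exists (K + L) => x Sx.
by rewrite (le_trans (ler_normD _ _))// lerD ?fK ?gL.
Qed.

Lemma bounded_onM f g : bounded_on S f -> bounded_on S g ->
  bounded_on S (fun x => f x * g x).
Proof.
move=> [K fK] [L gL]; exists (K * L) => x Sx.
by rewrite normrM ler_pM ?fK ?gL.
Qed.

Lemma bounded_onN f : bounded_on S f -> bounded_on S (fun x => - f x).
Proof. by move=> [K fK]; exists K => x Sx; rewrite normrN fK. Qed.

Lemma bounded_onB f g : bounded_on S f -> bounded_on S g ->
  bounded_on S (fun x => f x - g x).
Proof. by move=> bf bg; apply: bounded_onD => //; exact: bounded_onN. Qed.

Lemma bounded_onX f k : bounded_on S f -> bounded_on S (fun x => f x ^+ k).
Proof.
move=> [K fK]; exists (K ^+ k) => x Sx.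
by rewrite normrX lerXn2r ?nnegrE ?fK// (le_trans _ (fK x Sx)).
Qed.

Lemma bounded_on_sum (I : Type) (s : seq I) (F : I -> E -> R) :
  (forall i, bounded_on S (F i)) -> bounded_on S (fun x => \sum_(i <- s) F i x).
Proof.
move=> bF; elim: s => [|i s [K sK]].
  by exists 0 => x _; rewrite big_nil normr0.
have [L iL] := bF i; exists (L + K) => x Sx.
by rewrite big_cons (le_trans (ler_normD _ _))// lerD ?iL ?sK.
Qed.

End bounded_on.

Section discrete_expectation.
Context {R : realType} {E : choiceType} {S : set E} {d : measure_display}
  {T : measurableType d} {Pr : probability T R} {Z : T -> E}.
Hypothesis Scount : countable S.
Hypothesis ZS : forall w, S (Z w).
Hypothesis Zm : forall x, measurable [set w | Z w = x].

(** [E] carries no sigma-algebra here. Measurability comes from the events [Z = x]: every preimage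
    is a countable union of them, indexed through an injection [c] of [S] into [nat]. *)
Lemma measurable_comp_countable d' (U : measurableType d') (g : E -> U) :
  measurable_fun setT (g \o Z).
Proof.
move=> _ Y mY; rewrite setTI.
have /countable_injP[c cinj] := Scount.
have -> : (g \o Z) @^-1` Y = \bigcup_k [set w | c (Z w) = k /\ Y (g (Z w))].
  by apply/seteqP; split => [w gw|w [k _ []]//]; exists (c (Z w)).
apply: bigcupT_measurable => k.
have [[x [Sx cxk Ygx]]|nx] := pselect (exists x, [/\ S x, c x = k & Y (g x)]).
  rewrite (_ : [set w | _] = [set w | Z w = x]); first exact: Zm.
  apply/seteqP; split => [w [cZ _]|w /= ->//].
  by apply: (cinj _ _ (mem_set (ZS w)) (mem_set Sx)); rewrite cZ.
rewrite (_ : [set w | _] = set0)//.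
by apply/seteqP; split => // w [cZ YZ]; apply: nx; exists (Z w).
Qed.

Lemma integral_countable (g : E -> \bar R) : (forall x, S x -> 0 <= g x)%E ->
  (\int[Pr]_w g (Z w) = \esum_(x in S) (g x * Pr [set w | Z w = x]))%E.
Proof.
move=> g0.
have /countable_injP[c cinj] := Scount.
pose F k := [set w | c (Z w) = k].
have mF k : measurable (F k).
  rewrite -[F k]setTI.
  have mc := @measurable_comp_countable _ nat c.
  by apply: (mc measurableT [set k]).
have FT : \bigcup_k F k = setT by rewrite -subTset => w _; exists (c (Z w)).
have tF : trivIset setT F.
  apply/trivIsetP => i j _ _ ij; apply/seteqP; split => // w [Fi Fj].
  by move: ij; rewrite -Fi -Fj eqxx.
have mg : measurable_fun setT (g \o Z) by exact: measurable_comp_countable.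
rewrite -FT ge0_integral_bigcup//; [|by rewrite FT|by move=> w _; exact: g0].
rewrite nneseries_esumT; last first.
  by move=> k; apply: integral_ge0 => w _; exact: g0.
(* Indices outside the image of [c] have an empty [F k] and contribute nothing. *)
have -> : (\esum_(k in [set: nat]) \int[Pr]_(w in F k) g (Z w) =
           \esum_(k in c @` S) \int[Pr]_(w in F k) g (Z w))%E.
  rewrite [RHS]esum_mkcond; apply: eq_esum => k _; case: ifPn => // kS.
  rewrite (_ : F k = set0) ?integral_set0//; apply/seteqP; split => // w Fw.
  by move/negP: kS; apply; rewrite inE; exists (Z w).
rewrite (esum_image S c)//; apply: eq_esum => x Sx.
rewrite (_ : F (c x) = [set w | Z w = x]); last first.
  apply/seteqP; split => [w|w /= Zw]; last by rewrite /F /= Zw.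
  by move=> /cinj; rewrite !inE; exact.
rewrite (eq_integral (cst (g x))); last first.
  move=> w /set_mem /= Zw. by rewrite Zw.
by rewrite integral_cst.
Qed.

End discrete_expectation.

(** This is the real-valued integral, [fine] of the extended one, hence meaningful only when the
    latter is finite. The calculus below is therefore restricted to bounded functions. *)
Definition expect {R : realType} {d : measure_display} {T : measurableType d}
    (Pr : probability T R) (E : Type) (Z : T -> E) (g : E -> R) : R :=
  \int[Pr]_w g (Z w).

Section expect.
Context {R : realType} {E : choiceType} {S : set E} {d : measure_display}
  {T : measurableType d} {Pr : probability T R} {Z : T -> E}.
Hypothesis Scount : countable S.
Hypothesis ZS : forall w, S (Z w).
Hypothesis Zm : forall x, measurable [set w | Z w = x].
Implicit Types f g : E -> R.

Lemma bounded_on_integrable g : bounded_on S g ->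
  Pr.-integrable setT (EFin \o (g \o Z)).
Proof.
move=> [K gK]; apply: measurable_bounded_integrable => //.
- by rewrite [X in (X < _)%E](@probability_setT _ _ _ Pr) ltry.
- exact: (measurable_comp_countable Scount).
- exists K; split; first exact: num_real.
  by move=> M KM w _ /=; rewrite (le_trans (gK _ (ZS w)))// ltW.
Qed.

Lemma EFin_expect g : bounded_on S g ->
  (\int[Pr]_w (g (Z w))%:E = (expect Pr Z g)%:E)%E.
Proof. by move=> bg; rewrite fineK// integrable_fin_num// bounded_on_integrable. Qed.

Lemma expectD f g : bounded_on S f -> bounded_on S g ->
  expect Pr Z (fun x => f x + g x) = expect Pr Z f + expect Pr Z g.
Proof. by move=> bf bg; apply: RintegralD => //; exact: bounded_on_integrable. Qed.

Lemma expectB f g : bounded_on S f -> bounded_on S g ->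
  expect Pr Z (fun x => f x - g x) = expect Pr Z f - expect Pr Z g.
Proof. by move=> bf bg; apply: RintegralB => //; exact: bounded_on_integrable. Qed.

Lemma expectZ (c : R) g : bounded_on S g ->
  expect Pr Z (fun x => c * g x) = c * expect Pr Z g.
Proof. by move=> bg; apply: RintegralZl => //; exact: bounded_on_integrable. Qed.

Lemma expect_cst (c : R) : expect Pr Z (fun=> c) = c.
Proof.
by rewrite /expect Rintegral_cst// [X in fine X](@probability_setT _ _ _ Pr) mulr1.
Qed.

Lemma expect_le f g : bounded_on S f -> bounded_on S g ->
  (forall x, S x -> f x <= g x) -> expect Pr Z f <= expect Pr Z g.
Proof.
move=> bf bg fg; apply: le_Rintegral => //; try exact: bounded_on_integrable.
by move=> w _; exact: fg.
Qed.

(** Dominated convergence with the constant [K] as dominating function, integrable because [Pr] is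
    finite. *)
Lemma expect_cvg (K : R) (f : nat -> E -> R) g :
  (forall k x, S x -> `|f k x| <= K) ->
  (forall x, S x -> f ^~ x @ \oo --> g x) ->
  expect Pr Z (f k) @[k --> \oo] --> expect Pr Z g.
Proof.
move=> fK fg.
have bf k : bounded_on S (f k) by exists K => x; exact: fK.
have bg : bounded_on S g.
  exists K => x Sx.
  have h : `|f k x| @[k --> \oo] --> `|g x| by apply: cvg_norm; exact: fg.
  rewrite -(cvg_lim _ h)//; apply: limr_le; first exact: cvgP h.
  by apply: nearW => k; exact: fK.
have cE w : (f k (Z w))%:E @[k --> \oo] --> (g (Z w))%:E.
  by apply: cvg_EFin; [exact: nearW|exact: fg].
have [_ _] := @dominated_convergence _ T R Pr setT measurableT
  (fun k w => (f k (Z w))%:E) (fun w => (g (Z w))%:E) (fun=> K%:E)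
  (fun k => measurable_int Pr (bounded_on_integrable (bf k)))
  (measurable_int Pr (bounded_on_integrable bg))
  (aeW Pr (fun w _ => cE w))
  (finite_measure_integrable_cst Pr K measurableT)
  (aeW Pr (fun w k _ => fK k _ (ZS w))).
rewrite EFin_expect// => /fine_cvg; apply: cvg_trans.
by apply: near_eq_cvg; apply: nearW => k.
Qed.

End expect.

(** * Stationary laws of chains with bounded rates *)

(** Terms may have any sign, since [esum] is a supremum over finite subsets. *)
Lemma ler_sum_esum (R : realType) (E : choiceType) (S : set E) (s : seq E)
    (a : E -> R) : uniq s -> (forall y, y \in s -> S y) ->
  ((\sum_(y <- s) a y)%:E <= \esum_(y in S) (a y)%:E)%E.
Proof.
move=> us sS; apply: esum_ge; exists [set` s].
  by split; [exact: finite_seq|move=> y; exact: sS].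
by rewrite -fsbig_seq// sumEFin.
Qed.

Lemma bernoulli_ge (R : realDomainType) (x : R) (k : nat) :
  -1 <= x -> 1 + k%:R * x <= (1 + x) ^+ k.
Proof.
move=> x1; elim: k => [|k IH]; first by rewrite mul0r addr0 expr0.
rewrite exprSr -natr1.
apply: (@le_trans _ _ ((1 + k%:R * x) * (1 + x))); last first.
  by rewrite ler_wpM2r// -lerBlDl sub0r.
rewrite (_ : (1 + k%:R * x) * (1 + x) =
  1 + (k%:R + 1) * x + k%:R * (x * x)); last by ring.
by rewrite lerDl mulr_ge0// -expr2 sqr_ge0.
Qed.

(** * Transition probabilities and their derivative at time zero *)

Section transition_function.
Context {R : realType} {E : choiceType} {S : set E} {P : R -> E -> E -> R}.
Hypothesis trP : transition_function S P.

Lemma transition_ge0 t x y : 0 <= t -> S x -> S y -> 0 <= P t x y.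
Proof. by case: trP => + _ _ _; exact. Qed.

Lemma transition_sum_le1 t x (s : seq E) : 0 <= t -> S x -> uniq s ->
  (forall y, y \in s -> S y) -> \sum_(y <- s) P t x y <= 1.
Proof.
move=> t0 Sx us sS; case: trP => _ P1 _ _.
by rewrite -lee_fin -(P1 t x t0 Sx) ler_sum_esum.
Qed.

(** One way to be at [x] at time [k * t] is to be there at every multiple of [t]: the induction
    keeps only the term [z = x] of the Chapman-Kolmogorov sum. *)
Lemma transition_exp_le t x k : 0 <= t -> S x ->
  P t x x ^+ k <= P (k%:R * t) x x.
Proof.
move=> t0 Sx; case: trP => _ _ P0 PD; elim: k => [|k IH].
  by rewrite mul0r P0// eqxx.
rewrite exprSr -natr1 mulrDl mul1r.
apply: (@le_trans _ _ (P (k%:R * t) x x * P t x x)).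
  by rewrite ler_wpM2r// transition_ge0.
have kt0 : 0 <= k%:R * t by rewrite mulr_ge0.
rewrite -lee_fin -(PD _ _ x x kt0 t0 Sx Sx).
have := @ler_sum_esum R E S [:: x] (fun z => P (k%:R * t) x z * P t z x).
by rewrite big_seq1; apply => // y; rewrite inE => /eqP ->.
Qed.

Context {G : E -> E -> R}.
Hypothesis PG : has_q_matrix S P G.

Lemma cvg_rate (t : R) x y : 0 < t -> S x -> S y ->
  (t / k.+1%:R)^-1 * (P (t / k.+1%:R) x y - (x == y)%:R) @[k --> \oo] --> G x y.
Proof.
move=> t0 Sx Sy; have := PG Sx Sy => /cvg_at_rightP; apply; split.
  by move=> k; rewrite divr_gt0.
by rewrite -[X in _ --> X](mulr0 t); apply: cvgMr; exact: cvg_harmonic.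
Qed.

(* P t x x >= P (t / k) x x ^+ k turns the derivative at 0 into a bound valid at
   all times. *)
Lemma transition_stay_ge t x : 0 <= t -> S x -> 1 + t * G x x <= P t x x.
Proof.
rewrite le_eqVlt => /predU1P[<-|t0] Sx.
  by case: trP => _ _ P0 _; rewrite P0// eqxx mul0r addr0.
(* The slack [e] becomes a loss of slope [e / t], so that the difference quotients eventually exceed
   [G x x - e / t]. *)
apply/ler_addgt0Pr => e e0.
have et0 : 0 < e / t by rewrite divr_gt0.
have cG := cvg_rate t0 Sx Sx.
have ct : (t / k.+1%:R) * (G x x - e / t) @[k --> \oo] --> (0:R).
  rewrite [X in _ --> X](_ : 0 = t * 0 * (G x x - e / t)); last first.
    by rewrite mulr0 mul0r.
  by apply: cvgMl; apply: cvgMr; exact: cvg_harmonic.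
have near1 : \forall k \near \oo,
    G x x - e / t <= (t / k.+1%:R)^-1 * (P (t / k.+1%:R) x x - (x == x)%:R).
  by apply: cvgr_ge cG _ _; rewrite ltrBlDr ltrDl.
(* This is the condition for Bernoulli's inequality; it holds once the time step is small. *)
have near2 : \forall k \near \oo, -1 <= (t / k.+1%:R) * (G x x - e / t).
  by apply: cvgr_ge ct _ _; rewrite ltrN10.
near \oo => k.
have k1 : G x x - e / t <= (t / k.+1%:R)^-1 * (P (t / k.+1%:R) x x - (x == x)%:R).
  by near: k.
have k2 : -1 <= (t / k.+1%:R) * (G x x - e / t) by near: k.
set h := t / k.+1%:R in k1 k2.
have h0 : 0 < h by rewrite divr_gt0.
have kh : k.+1%:R * h = t by rewrite mulrC divfK.
have hP : 1 + h * (G x x - e / t) <= P h x x.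
  move: k1; rewrite eqxx [X in _ <= X]mulrC ler_pdivlMr// => k1.
  by rewrite -lerBrDl mulrC.
have := transition_exp_le k.+1 (ltW h0) Sx; rewrite kh.
rewrite -lerBlDr; apply: le_trans.
apply: (@le_trans _ _ ((1 + h * (G x x - e / t)) ^+ k.+1)).
  apply: le_trans (bernoulli_ge k.+1 k2).
  by rewrite mulrA kh mulrBr mulrCA divff ?gt_eqF// mulr1 addrA.
by rewrite lerXn2r// nnegrE ?(le_trans _ hP)// -lerBlDl sub0r.
Unshelve. all: by end_near. Qed.

End transition_function.

(** * Scaling and exchanging nonnegative sums *)

Lemma esumZl (R : realType) (E : choiceType) (S : set E) (c : R)
    (a : E -> \bar R) : 0 <= c -> (forall x, S x -> 0 <= a x)%E ->
  (\esum_(x in S) (c%:E * a x) = c%:E * \esum_(x in S) a x)%E.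
Proof.
move=> c0 a0; rewrite /esum -ereal_supZl//; last first.
  by apply/set0P; exists (\sum_(x \in set0) a x)%E, set0; first exact: fsets_set0.
rewrite image_comp; congr ereal_sup; apply: eq_imagel => X [finX XS] /=.
rewrite !fsbig_finite//= big_seq [in RHS]big_seq ge0_sume_distrr// => x.
by rewrite in_fset_set// inE => /XS /a0.
Qed.

(** Tonelli's theorem for sums: both sides are sums over the product set, up to swapping
    coordinates. *)
Lemma esum_interchange (R : realType) (E E' : choiceType) (S : set E)
    (S' : set E') (a : E -> E' -> \bar R) :
  (forall x y, S x -> S' y -> 0 <= a x y)%E ->
  (\esum_(x in S) \esum_(y in S') a x y =
   \esum_(y in S') \esum_(x in S) a x y)%E.
Proof.
move=> a0; rewrite !esum_esum//; last by move=> y x Sy Sx; exact: a0.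
rewrite (@reindex_esum _ _ _ (S' `*`` (fun=> S)) _ (fun x => (x.2, x.1)))//.
split; first by move=> [y x] [].
- by move=> [i j] [k l] _ _ [-> ->].
- by move=> [x y] [Sx Sy]; exists (y, x).
Qed.

(** * The generator has mean zero under a stationary law *)

Section stationary_generator.
Context {R : realType} {E : choiceType} {S : set E}.
Variables (r : E -> E -> R) (P : R -> E -> E -> R) (N : E -> seq E) (K : R).
Hypothesis chainP : markov_chain_with_rates S r P.
Hypothesis N_uniq : forall x, S x -> uniq (N x).
Hypothesis N_sub : forall x y, S x -> y \in N x -> S y.
Hypothesis N_irr : forall x, S x -> x \notin N x.
Hypothesis r_ge0 : forall x y, S x -> S y -> y != x -> 0 <= r x y.
Hypothesis r_eq0 : forall x y, S x -> S y -> y != x -> y \notin N x -> r x y = 0.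
Hypothesis r_le : forall x, S x -> \sum_(y <- N x) r x y <= K.

(** [N x] lists finitely many states and contains every target of a jump from [x] with nonzero rate,
    so no convergence question arises. *)
Definition generator (f : E -> R) (x : E) : R :=
  \sum_(y <- N x) r x y * (f y - f x).

Lemma q_matrix_diag x : S x ->
  q_matrix S r x x = - \sum_(y <- N x) r x y.
Proof.
move=> Sx; rewrite /q_matrix eqxx; congr (- _).
have -> : (\esum_(z in S `\ x) (r x z)%:E =
           \esum_(z in [set` N x]) (r x z)%:E)%E.
  rewrite [LHS]esum_mkcond [RHS]esum_mkcond; apply: eq_esum => z _.
  case: ifPn => zS; case: ifPn => zN //.
    move: zS zN; rewrite inE notin_setE /= => -[Sz /eqP zx] /negP zN.
    by rewrite r_eq0.
  move: zS zN; rewrite notin_setE inE/= => zS zN; exfalso; apply: zS.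
  split; first exact: N_sub zN.
  by move=> zx; move: zN (N_irr Sx); rewrite zx => ->.
rewrite esum_fset//; last first.
  move=> z; rewrite inE/= => zN; rewrite lee_fin r_ge0//; first exact: N_sub zN.
  by apply: contraNneq (N_irr Sx) => zx; rewrite -{1}zx.
by rewrite -fsbig_seq ?N_uniq// sumEFin.
Qed.

Lemma q_matrix_offdiag x y : S x -> y \in N x -> q_matrix S r x y = r x y.
Proof.
move=> Sx yN; rewrite /q_matrix ifN//.
by apply: contraNneq (N_irr Sx) => xy; rewrite {1}xy.
Qed.

Context {d : measure_display} {T : measurableType d} {Pr : probability T R}
  {Z : T -> E}.
Hypothesis Scount : countable S.
Hypothesis ZS : forall w, S (Z w).
Hypothesis Zm : forall x, measurable [set w | Z w = x].
Hypothesis invP : invariant_law S P (fun x => Pr [set w | Z w = x]).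

(** Summed over all [y] in [S], the left side would equal the right side by invariance; the terms
    outside [x :: N x] are nonnegative. *)
Lemma expect_transition_le (t : R) (f : E -> R) : 0 <= t ->
  bounded_on S f -> (forall x, S x -> 0 <= f x) ->
  expect Pr Z (fun x => \sum_(y <- x :: N x) P t x y * f y) <= expect Pr Z f.
Proof.
move=> t0 [F fF] f0; have [trP _] := chainP.
have xNu x : S x -> uniq (x :: N x) by move=> Sx /=; rewrite N_irr// N_uniq.
have xNS x y : S x -> y \in x :: N x -> S y.
  by move=> Sx; rewrite inE => /predU1P[->//|]; exact: N_sub.
have P0 x y : S x -> S y -> 0 <= P t x y.
  by move=> Sx Sy; exact: (transition_ge0 trP).
have bA : bounded_on S (fun x => \sum_(y <- x :: N x) P t x y * f y).
  exists F => x Sx; rewrite ger0_norm; last first.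
    rewrite big_seq; apply: sumr_ge0 => y yN.
    by rewrite mulr_ge0 ?P0 ?f0//; exact: xNS yN.
  apply: (@le_trans _ _ (\sum_(y <- x :: N x) P t x y * F)).
    rewrite big_seq [leRHS]big_seq; apply: ler_sum => y yN.
    have Sy := xNS _ _ Sx yN.
    by rewrite ler_wpM2l ?P0// (le_trans (ler_norm _)) ?fF.
  have F0 : 0 <= F by rewrite (le_trans _ (fF x Sx)).
  rewrite -mulr_suml ler_piMl//.
  exact: (transition_sum_le1 trP t0 Sx (xNu _ Sx) (fun y => xNS x y Sx)).
pose p x := fine (Pr [set w | Z w = x]).
have pE x : Pr [set w | Z w = x] = (p x)%:E.
  by rewrite fineK// fin_num_measure//; exact: Zm.
have p0 x : 0 <= p x by rewrite fine_ge0.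
rewrite -lee_fin -!(EFin_expect Scount ZS Zm)//; last by exists F.
rewrite (integral_countable Scount ZS Zm (g := fun x => (f x)%:E)); last first.
  by move=> x Sx; rewrite lee_fin f0.
rewrite (integral_countable Scount ZS Zm
  (g := fun x => (\sum_(y <- x :: N x) P t x y * f y)%:E)); last first.
  move=> x Sx; rewrite lee_fin big_seq; apply: sumr_ge0 => y yN.
  by rewrite mulr_ge0 ?P0 ?f0//; exact: xNS yN.
apply: (@le_trans _ _
    (\esum_(x in S) \esum_(y in S) ((f y)%:E * (p x * P t x y)%:E))%E).
  apply: le_esum => x Sx; rewrite pE -EFinM mulr_suml.
  rewrite (eq_bigr (fun y => f y * (p x * P t x y))); last by move=> y _; ring.
  apply: le_trans (ler_sum_esum _ (xNu _ Sx) (fun y => xNS x y Sx)) _.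
  by apply: le_esum => y _; rewrite EFinM.
(* The sum over starting states is moved inside, where invariance evaluates it. *)
rewrite esum_interchange; last first.
  by move=> x y Sx Sy; rewrite -EFinM lee_fin !mulr_ge0 ?f0 ?P0.
apply: le_esum => y Sy; rewrite esumZl ?f0//; last first.
  by move=> x Sx; rewrite lee_fin mulr_ge0// P0.
rewrite lee_wpmul2l ?lee_fin ?f0// -(invP t0 Sy).
by apply: le_esum => x _; rewrite pE EFinM.
Qed.

Lemma bounded_on_generator (f : E -> R) : bounded_on S f ->
  bounded_on S (generator f).
Proof.
move=> [F fF]; exists (K * (F + F)) => x Sx.
have F0 : 0 <= F by rewrite (le_trans _ (fF x Sx)).
apply: (@le_trans _ _ (\sum_(y <- N x) r x y * (F + F))); last first.
  by rewrite -mulr_suml ler_wpM2r ?addr_ge0 ?r_le.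
apply: le_trans (ler_norm_sum _ _ _) _.
rewrite big_seq [leRHS]big_seq; apply: ler_sum => y yN.
have Sy := N_sub Sx yN.
have r0 : 0 <= r x y.
  by apply: r_ge0 => //; apply: contraNneq (N_irr Sx) => yx; rewrite -{1}yx.
rewrite normrM ger0_norm// ler_wpM2l//.
by rewrite (le_trans (ler_normB _ _))// lerD ?fF.
Qed.

(* Keeping only the jumps from x to x and to N x bounds the transition operator
   from below on f >= 0, so no control on the remaining, infinitely many states
   is needed. *)
Lemma expect_generator_le0 (f : E -> R) : bounded_on S f ->
  (forall x, S x -> 0 <= f x) -> expect Pr Z (generator f) <= 0.
Proof.
move=> bf f0; have [F fF] := bf; have [trP PG] := chainP.
pose h k : R := 1 / k.+1%:R.
have h0 k : 0 < h k by rewrite divr_gt0.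
pose D k x := (h k)^-1 *
  (\sum_(y <- x :: N x) P (h k) x y * f y - f x).
have DE k x : D k x = (h k)^-1 * (P (h k) x x - 1) * f x +
    \sum_(y <- N x) ((h k)^-1 * P (h k) x y) * f y.
  rewrite /D big_cons addrAC mulrDr -{2}(mul1r (f x)) -mulrBl mulrA mulr_sumr.
  by congr (_ + _); apply: eq_bigr => y _; rewrite mulrA.
have rN x y : S x -> y \in N x -> y != x.
  by move=> Sx yN; apply: contraNneq (N_irr Sx) => yx; rewrite -{1}yx.
have cD x : S x -> D ^~ x @ \oo --> generator f x.
  move=> Sx.
  rewrite (_ : generator f x =
    q_matrix S r x x * f x + \sum_(y <- N x) q_matrix S r x y * f y); last first.
    rewrite q_matrix_diag// /generator.
    rewrite big_seq [X in _ + X]big_seq mulNr addrC [X in X * f x]big_seq.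
    rewrite mulr_suml -sumrB; apply: eq_bigr => y yN.
    by rewrite q_matrix_offdiag// mulrBr.
  under eq_fun do rewrite DE.
  apply: cvgD.
    apply: cvgMl; have := cvg_rate PG ltr01 Sx Sx.
    by under eq_fun do rewrite eqxx.
  rewrite big_seq; under eq_fun do rewrite big_seq.
  apply: cvg_big => [|y yN]; first exact: add_continuous.
  apply: cvgMl; have := cvg_rate PG ltr01 Sx (N_sub Sx yN).
  by under eq_fun do rewrite eq_sym (negbTE (rN _ _ Sx yN)) subr0.
(* Domination uniform in [k] and [x]: [transition_stay_ge] bounds the rate of having left [x] after
   time [h k] by [K], and since the total mass is at most 1, the rate of being in [N x] has the same
   bound. *)
have bD k x : S x -> `|D k x| <= K * F + K * F.
  move=> Sx; rewrite DE.
  have hk := h0 k.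
  have stay : (h k)^-1 * (1 - P (h k) x x) <= K.
    rewrite mulrC ler_pdivrMr//.
    have := transition_stay_ge trP PG (ltW hk) Sx.
    rewrite q_matrix_diag// mulrN lerBlDl -lerBlDr => /le_trans; apply.
    by rewrite mulrC ler_wpM2r ?r_le// ltW.
  have P0 y : S y -> 0 <= P (h k) x y.
    by move=> Sy; exact: (transition_ge0 trP (ltW hk)).
  have P1 : \sum_(y <- x :: N x) P (h k) x y <= 1.
    apply: (transition_sum_le1 trP (ltW hk) Sx) => [|y].
      by rewrite /= N_irr// N_uniq.
    by rewrite inE => /predU1P[->//|]; exact: N_sub.
  rewrite big_cons in P1.
  have s0 : 0 <= \sum_(y <- N x) P (h k) x y.
    by rewrite big_seq; apply: sumr_ge0 => y yN; apply: P0; exact: N_sub yN.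
  have K0 : 0 <= K.
    apply: le_trans stay; apply: mulr_ge0; first by rewrite invr_ge0 ltW.
    by rewrite subr_ge0 (le_trans _ P1)// lerDl.
  apply: le_trans (ler_normD _ _) _; apply: lerD.
    rewrite normrM ler_pM ?fF// normrM gtr0_norm ?invr_gt0//.
    rewrite ler0_norm ?opprB// subr_le0 (le_trans _ P1)// lerDl//.
  apply: (@le_trans _ _ (\sum_(y <- N x) ((h k)^-1 * P (h k) x y) * F)).
    apply: le_trans (ler_norm_sum _ _ _) _.
    rewrite big_seq [leRHS]big_seq; apply: ler_sum => y yN.
    have Sy := N_sub Sx yN.
    have hP : 0 <= (h k)^-1 * P (h k) x y by rewrite mulr_ge0 ?P0// invr_ge0 ltW.
    by rewrite normrM ler_pM ?fF// ger0_norm.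
  rewrite -mulr_suml ler_wpM2r ?(le_trans _ (fF x Sx))// -mulr_sumr.
  apply: le_trans stay; rewrite ler_pM2l ?invr_gt0//.
  by rewrite lerBrDl.
(* It remains to see that each [D k] has mean at most 0, which is [expect_transition_le] divided by
   [h k]. *)
have limD := expect_cvg Scount ZS Zm bD cD (Pr := Pr).
rewrite -(cvg_lim _ limD)//; apply: limr_le; first exact: cvgP limD.
apply: nearW => k.
have hk := h0 k.
have bA : bounded_on S (fun x => \sum_(y <- x :: N x) P (h k) x y * f y).
  have : bounded_on S (fun x => h k * D k x + f x).
    apply: bounded_onD => //; apply: bounded_onM; first exact: bounded_on_cst.
    by exists (K * F + K * F) => x; exact: bD.
  by under eq_fun do rewrite mulrA divff ?gt_eqF// mul1r subrK.
rewrite /D (expectZ Scount ZS Zm) ?(expectB Scount ZS Zm)//; last exact: bounded_onB.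
rewrite pmulr_rle0 ?invr_gt0// subr_le0.
by apply: expect_transition_le => //; rewrite ltW.
Qed.

(** The one-sided inequality applies to [F + f] and to [F - f], both nonnegative when [F] bounds the
    absolute value of [f]; the generator kills the constant [F]. *)
Lemma expect_generator (f : E -> R) : bounded_on S f ->
  expect Pr Z (generator f) = 0.
Proof.
move=> bf; have [F fF] := bf.
have genD : generator (fun x => F + f x) = generator f.
  by apply/funext => x; apply: eq_bigr => y _; congr (_ * _); ring.
have genB : generator (fun x => F - f x) = (fun x => -1 * generator f x).
  apply/funext => x; rewrite mulr_sumr; apply: eq_bigr => y _; ring.
have fle x : S x -> - F <= f x <= F by move=> Sx; rewrite -ler_norml fF.
apply/eqP; rewrite eq_le; apply/andP; split.
  rewrite -genD; apply: expect_generator_le0 => [|x /fle/andP[Ff _]].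
    by apply: bounded_onD => //; exact: bounded_on_cst.
  by rewrite -lerBlDl sub0r.
rewrite -oppr_le0 -mulN1r -(expectZ Scount ZS Zm); last first.
  exact: bounded_on_generator.
rewrite -genB; apply: expect_generator_le0 => [|x /fle/andP[_ fF']].
  by apply: bounded_onB => //; exact: bounded_on_cst.
by rewrite subr_ge0.
Qed.

End stationary_generator.

(** * The Join the Shortest Queue chain *)

Lemma nneseries_finite_support (R : realType) (u : nat -> \bar R) (m k : nat) :
  (forall i, (k <= i)%N -> u i = 0%E) ->
  (\sum_(m <= i <oo) u i = \sum_(m <= i < k) u i)%E.
Proof.
move=> u0; apply: lim_near_cst => //; near=> N.
have kN : (k <= N)%N by near: N; exact: nbhs_infty_ge.
have [mk|km] := leqP m k.
  rewrite (big_cat_nat mk kN)/= [X in (_ + X)%E]big1_seq ?adde0//.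
  by move=> i /andP[_]; rewrite mem_index_iota => /andP[ki _]; exact: u0.
rewrite [RHS]big_geq 1?ltnW// big1_seq// => i /andP[_].
rewrite mem_index_iota => /andP[mi _]; rewrite u0// (leq_trans (ltnW km)).
Unshelve. all: by end_near. Qed.

Section jsq_chain.
Context {R : realType} (n : nat) {lambda : R}.
Hypothesis n_gt0 : (0 < n)%N.
Hypothesis lambda_ge0 : 0 <= lambda.
Local Notation S := (jsq_space R n).
Implicit Types (q : nat -> nat) (i j k m : nat).

(** A nonincreasing sequence of integers that never vanishes stays at least 1, so its series
    diverges. *)
Lemma jsq_spaceP q : S q <-> [/\ q 0%N = n, forall i, (q i.+1 <= q i)%N &
  exists m, forall i, (m <= i)%N -> q i = 0%N].
Proof.
split=> [[q0 qS qfin]|[q0 qS [m qm]]]; split => //; last first.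
  rewrite (@nneseries_finite_support _ _ _ m); last by move=> i /qm ->.
  by rewrite sumEFin ltry.
have qle i j : (i <= j)%N -> (q j <= q i)%N.
  elim: j => [|j IH]; rewrite leq_eqVlt => /predU1P[->//|] // /IH.
  exact: leq_trans.
have [[m qm]|nq] := pselect (exists m, q m = 0%N).
  by exists m => i /qle; rewrite qm leqn0 => /eqP.
have qgt0 i : (0 < q i)%N by rewrite lt0n; apply/eqP => qi; apply: nq; exists i.
move: qfin; set s := (\sum_(1 <= i <oo) _)%E => sfin.
have sfin' : s \is a fin_num.
  by rewrite ge0_fin_numE//; apply: nneseries_ge0 => i _ _; rewrite lee_fin.
exfalso; have [k sk] : exists k, fine s < k%:R.
  by exists (Num.truncn (fine s)).+1; exact: truncnS_gt.
suff : k%:R <= fine s by rewrite leNgt sk.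
rewrite -lee_fin fineK//.
have le_s := @nneseries_lim_ge R (fun i => (q i)%:R%:E) xpredT 1 k.+1.
apply: le_trans (le_s _); last by move=> i _ _; rewrite lee_fin.
rewrite sumEFin lee_fin -natr_sum ler_nat.
rewrite -[leqLHS](subn1 k.+1) -[leqLHS]muln1 -sum_nat_const_nat.
by apply: leq_sum => i _; exact: qgt0.
Qed.

Lemma jsq_nonincr q i j : S q -> (i <= j)%N -> (q j <= q i)%N.
Proof.
move=> [_ qS _]; elim: j => [|j IH]; rewrite leq_eqVlt => /predU1P[->//|] //.
by move=> /IH; exact: leq_trans.
Qed.

Lemma jsq_le q i : S q -> (q i <= n)%N.
Proof. by move=> Sq; have [<- _ _] := Sq; exact: jsq_nonincr. Qed.

(** Every state is a finite list padded with zeros. *)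
Lemma countable_jsq_space : countable S.
Proof.
apply: (@sub_countable _ _ _ [set: seq nat]) => //.
apply: card_le_trans (card_image_le (fun s : seq nat => nth 0%N s) [set: seq nat]).
apply: subset_card_le => q /jsq_spaceP[_ _ [m qm]].
exists (mkseq q m) => //; apply/funext => i.
have [im|mi] := ltnP i m; first by rewrite nth_mkseq.
by rewrite nth_default ?size_mkseq// qm.
Qed.

(** The level raised by an arrival. On the state space the default 0 is never returned, by
    [arrival_indexP]. *)
Definition arrival_index q : nat :=
  xget 0%N [set i | [/\ (1 <= i)%N, forall j, (1 <= j < i)%N -> q j = n &
    (q i < n)%N]].

(** Some level from which [q] vanishes, chosen arbitrarily rather than least. *)
Definition support_bound q : nat :=
  xget 0%N [set m | forall i, (m <= i)%N -> q i = 0%N].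

Lemma support_boundP q i : S q -> (support_bound q <= i)%N -> q i = 0%N.
Proof. by move=> /jsq_spaceP[_ _ ex]; have := xgetPex 0%N ex; apply. Qed.

Lemma arrival_indexP q : S q -> [/\ (1 <= arrival_index q)%N,
  forall j, (1 <= j < arrival_index q)%N -> q j = n &
  (q (arrival_index q) < n)%N].
Proof.
move=> Sq.
suff : exists i, [/\ (1 <= i)%N, forall j, (1 <= j < i)%N -> q j = n &
    (q i < n)%N].
  by move=> ex; exact: (xgetPex 0%N ex).
have ex : exists i, (q i < n)%N.
  by exists (support_bound q); rewrite (support_boundP Sq (leqnn _)).
case: (ex_minnP ex) => i qi imin; exists i; split => //.
  (* The first level with room is not 0, where [q] equals [n]. *)
  by case: i qi {imin} => // /=; have [-> _ _] := Sq; rewrite ltnn.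
move=> j /andP[_ ji]; apply/eqP; rewrite eqn_leq jsq_le//= leqNgt.
by apply/negP => /imin; rewrite leqNgt ji.
Qed.

Lemma arrival_index_uniq q i : S q -> (1 <= i)%N ->
  (forall j, (1 <= j < i)%N -> q j = n) -> (q i < n)%N -> i = arrival_index q.
Proof.
move=> Sq i1 qi qin; have [a1 qa qan] := arrival_indexP Sq.
have [ia|ai|//] := ltngtP i (arrival_index q).
  by move: qin; rewrite qa ?i1// ltnn.
by move: qan; rewrite qi ?a1// ltnn.
Qed.

Lemma arrival_rateE q i : S q -> (1 <= i)%N ->
  arrival_rate n lambda q i = n%:R * lambda * (i == arrival_index q)%:R.
Proof.
move=> Sq i1; rewrite /arrival_rate; congr (_ * (nat_of_bool _)%:R).
have [_ qa qan] := arrival_indexP Sq.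
apply/asboolP/eqP => [[qi qin]|->//]; exact: arrival_index_uniq.
Qed.

Lemma departure_rate_ge0 q i : S q -> 0 <= departure_rate R q i.
Proof. by move=> [_ qS _]; rewrite subr_ge0 ler_nat. Qed.

(** The defining series collapses: an arrival has a single target level, and departure rates vanish
    beyond the support. *)
Lemma jsq_rateE q q' : S q -> jsq_rate n lambda q q' =
  n%:R * lambda * (q' == add_unit (arrival_index q) q)%:R +
  \sum_(i <- iota 1 (support_bound q))
    (q' == sub_unit i q)%:R * departure_rate R q i.
Proof.
move=> Sq; have [a1 _ _] := arrival_indexP Sq.
pose k := maxn (arrival_index q).+1 (support_bound q).+1.
rewrite /jsq_rate (@nneseries_finite_support _ _ _ k); last first.
  move=> i; rewrite geq_max => /andP[ai mi].
  rewrite arrival_rateE// ?(leq_trans _ (ltnW ai))// (gtn_eqF ai) !mulr0 add0r.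
  rewrite /departure_rate (support_boundP Sq (ltnW mi)).
  by rewrite (support_boundP Sq (leqW (ltnW mi))) subr0 mulr0.
rewrite sumEFin/= big_split/=; congr (_ + _).
  rewrite (bigD1_seq (arrival_index q)) ?iota_uniq//=; last first.
    by rewrite mem_index_iota a1 leq_max leqnn.
  rewrite arrival_rateE// eqxx mulr1 [X in _ + X]big1_seq ?addr0.
    by rewrite [LHS]mulrC; congr (_ * (nat_of_bool _)%:R).
  move=> i /andP[ia]; rewrite mem_index_iota => /andP[i1 _].
  by rewrite arrival_rateE// (negbTE ia) !mulr0.
have mk : ((support_bound q).+1 <= k)%N by rewrite leq_max leqnn orbT.
rewrite (big_cat_nat (n := (support_bound q).+1))//=.
rewrite [X in _ + X]big1_seq ?addr0; last first.
  move=> i /andP[_]; rewrite mem_index_iota => /andP[mi _].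
  rewrite /departure_rate (support_boundP Sq (ltnW mi)).
  by rewrite (support_boundP Sq (leqW (ltnW mi))) subr0 mulr0.
rewrite /index_iota subn1/=; apply: eq_bigr => i _.
by congr ((nat_of_bool _)%:R * _).
Qed.

(** The filter removes departures of rate zero. Their target would be [q] itself when [q i = 0], and
    would violate monotonicity otherwise. *)
Definition jsq_neighbours q : seq (nat -> nat) :=
  add_unit (arrival_index q) q ::
  [seq sub_unit i q | i <- iota 1 (support_bound q) & (q i.+1 < q i)%N].

Lemma sub_unit_eq q i j : (0 < q i)%N ->
  (sub_unit i q == sub_unit j q) = (i == j).
Proof.
move=> qi; apply/eqP/eqP => [/(congr1 (fun q' => q' i))|->//].
rewrite /sub_unit eqxx; case: eqP => // _.
by rewrite subn0 subn1 => /eqP; rewrite ltn_eqF// prednK.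
Qed.

Lemma add_sub_unit_neq q i j : add_unit i q != sub_unit j q.
Proof.
apply/eqP => /(congr1 (fun q' => q' i)); rewrite /add_unit /sub_unit eqxx => qi.
by have := leq_subr (i == j) (q i); rewrite -qi addn1 ltnn.
Qed.

Lemma jsq_neighbours_uniq q : uniq (jsq_neighbours q).
Proof.
rewrite /jsq_neighbours cons_uniq; apply/andP; split.
  apply/mapP => -[i _ /eqP]; apply/negP; exact: add_sub_unit_neq.
rewrite map_inj_in_uniq ?filter_uniq ?iota_uniq// => i j.
rewrite mem_filter => /andP[qi _] _ /eqP; rewrite sub_unit_eq => [/eqP//|].
exact: leq_ltn_trans qi.
Qed.

Lemma jsq_neighbours_irr q : q \notin jsq_neighbours q.
Proof.
rewrite inE negb_or; apply/andP; split.
  apply/eqP => /(congr1 (fun q' => q' (arrival_index q))).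
  by rewrite /add_unit eqxx => /eqP; rewrite addn1 ltn_eqF.
apply/mapP => -[i]; rewrite mem_filter => /andP[qi _].
move=> /(congr1 (fun q' => q' i)); rewrite /sub_unit eqxx subn1 => /eqP.
by rewrite gtn_eqF// prednK// (leq_ltn_trans _ qi).
Qed.

Lemma jsq_neighbours_sub q q' : S q -> q' \in jsq_neighbours q -> S q'.
Proof.
move=> Sq; have [q0 qS _] := Sq; rewrite inE => /predU1P[->|].
  have [a1 qa qan] := arrival_indexP Sq; apply/jsq_spaceP; split.
  - rewrite /add_unit q0 (_ : 0%N == _ = false) ?addn0//.
    by apply/negbTE; rewrite eq_sym -lt0n.
  - move=> i; rewrite /add_unit; have [ia|ia] := eqVneq i.+1 (arrival_index q).
      rewrite ia addn1 (leq_trans qan)// (_ : q i = n) ?leq_addr//.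
      by case: i ia => // i ia; rewrite qa// -ia ltnS/=.
    by rewrite addn0 (leq_trans (qS i))// leq_addr.
  - exists (maxn (arrival_index q).+1 (support_bound q)) => i.
    rewrite geq_max => /andP[ai mi].
    by rewrite /add_unit (gtn_eqF ai) addn0 (support_boundP Sq mi).
move=> /mapP[i]; rewrite mem_filter mem_iota => /andP[qi /andP[i1 _]] ->.
apply/jsq_spaceP; split.
- by rewrite /sub_unit q0 (_ : 0%N == i = false) ?subn0//; case: i i1 {qi}.
- move=> j; rewrite /sub_unit; have [->|ji] := eqVneq j i.
    by rewrite (gtn_eqF (ltnSn i)) subn0 subn1 -ltnS prednK// (leq_ltn_trans _ qi).
  by rewrite subn0 (leq_trans (leq_subr _ _)).
- exists (support_bound q) => j mj.
  by rewrite /sub_unit (support_boundP Sq mj).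
Qed.

Lemma jsq_rate_add q : S q ->
  jsq_rate n lambda q (add_unit (arrival_index q) q) = n%:R * lambda.
Proof.
move=> Sq; rewrite jsq_rateE// eqxx mulr1 big1 ?addr0// => i _.
by rewrite (negbTE (add_sub_unit_neq _ _ _)) mul0r.
Qed.

Lemma jsq_rate_sub q i : S q -> i \in iota 1 (support_bound q) ->
  (q i.+1 < q i)%N -> jsq_rate n lambda q (sub_unit i q) = departure_rate R q i.
Proof.
move=> Sq im qi; rewrite jsq_rateE// eq_sym (negbTE (add_sub_unit_neq _ _ _)).
have qi0 : (0 < q i)%N by exact: leq_ltn_trans qi.
rewrite mulr0 add0r (bigD1_seq i) ?iota_uniq//= eqxx mul1r big1 ?addr0//.
by move=> j ji; rewrite sub_unit_eq// eq_sym (negbTE ji) mul0r.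
Qed.

Lemma jsq_rate_ge0 q q' : S q -> 0 <= jsq_rate n lambda q q'.
Proof.
move=> Sq; rewrite jsq_rateE// addr_ge0 ?mulr_ge0// sumr_ge0// => i _.
by rewrite mulr_ge0// departure_rate_ge0.
Qed.

Lemma jsq_rate_eq0 q q' : S q -> q' \notin jsq_neighbours q ->
  jsq_rate n lambda q q' = 0.
Proof.
move=> Sq; rewrite inE negb_or => /andP[/negbTE qa /mapP qs].
rewrite jsq_rateE// qa mulr0 add0r big_seq big1// => i im.
have [qi|qi] := ltnP (q i.+1) (q i).
  have [qq|_] := eqVneq q' (sub_unit i q); last by rewrite mul0r.
  by exfalso; apply: qs; exists i => //; rewrite mem_filter qi.
have [_ qS _] := Sq.
have qii : q i = q i.+1 by apply/eqP; rewrite eqn_leq qi qS.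
by rewrite /departure_rate qii subrr mulr0.
Qed.

Lemma sum_jsq_neighbours q (g : (nat -> nat) -> R) : S q ->
  \sum_(y <- jsq_neighbours q) jsq_rate n lambda q y * g y =
  n%:R * lambda * g (add_unit (arrival_index q) q) +
  \sum_(i <- iota 1 (support_bound q)) departure_rate R q i * g (sub_unit i q).
Proof.
move=> Sq; rewrite big_cons jsq_rate_add// big_map big_filter; congr (_ + _).
rewrite big_mkcond big_seq [RHS]big_seq; apply: eq_bigr => i im.
case: ifPn => [qi|]; first by rewrite jsq_rate_sub.
have [_ qS _] := Sq.
rewrite -leqNgt => qi.
have qii : q i = q i.+1 by apply/eqP; rewrite eqn_leq qi qS.
by rewrite /departure_rate qii subrr mul0r.
Qed.

(** The departure rates telescope to at most [q 1], the number of busy servers. *)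
Lemma jsq_rate_le q : S q ->
  \sum_(y <- jsq_neighbours q) jsq_rate n lambda q y <= n%:R * lambda + n%:R.
Proof.
move=> Sq; have := sum_jsq_neighbours (fun=> 1) Sq.
under eq_bigr do rewrite mulr1; move=> ->; rewrite mulr1 lerD2l.
under eq_bigr do rewrite mulr1.
have -> : iota 1 (support_bound q) = index_iota 1 (support_bound q).+1.
  by rewrite /index_iota subn1.
rewrite -[leLHS]opprK -sumrN.
under eq_bigr do rewrite opprB.
rewrite (telescope_sumr (fun i => (q i)%:R))// opprB lerBlDr.
by rewrite (le_trans (y := n%:R))// ?ler_nat ?jsq_le// lerDl.
Qed.

(** * The generator on functions of finitely many levels *)

Local Notation gen := (generator (jsq_rate n lambda) jsq_neighbours).

Lemma jsq_generatorE (f : (nat -> nat) -> R) k q : S q ->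
  (forall i, (k <= i)%N -> f (sub_unit i q) = f q) ->
  gen f q = n%:R * lambda * (f (add_unit (arrival_index q) q) - f q) +
    \sum_(1 <= i < k) departure_rate R q i * (f (sub_unit i q) - f q).
Proof.
move=> Sq fk; rewrite /generator (sum_jsq_neighbours (fun y => f y - f q))//.
congr (_ + _).
pose F i := departure_rate R q i * (f (sub_unit i q) - f q).
have Fk i : (k <= i)%N -> F i = 0 by move=> ki; rewrite /F fk// subrr mulr0.
have Fm i : ((support_bound q).+1 <= i)%N -> F i = 0.
  move=> mi; rewrite /F /departure_rate (support_boundP Sq (ltnW mi)).
  by rewrite (support_boundP Sq (leqW (ltnW mi))) subrr mul0r.
have -> : iota 1 (support_bound q) = index_iota 1 (support_bound q).+1.
  by rewrite /index_iota subn1.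
(* Both finite sums equal the same series, which avoids comparing [k] with the support bound. *)
have eqF m : (forall i, (m <= i)%N -> F i = 0) ->
    (\sum_(1 <= i <oo) (F i)%:E)%E = (\sum_(1 <= i < m) F i)%:E.
  by move=> F0; rewrite (@nneseries_finite_support _ _ _ m) ?sumEFin// => i /F0 ->.
by apply: EFin_inj; rewrite -(eqF _ Fk) -(eqF _ Fm).
Qed.

End jsq_chain.

(** * Drift inequalities *)

Section jsq_drift.
Context {R : realType} (n : nat) (lambda : R).
Hypothesis n_gt0 : (0 < n)%N.
Hypothesis lambda_ge0 : 0 <= lambda.
Hypothesis lambda_le1 : lambda <= 1.
Local Notation S := (jsq_space R n).
Local Notation gen := (generator (jsq_rate n lambda) (jsq_neighbours n)).
Local Notation N := (n%:R : R).
Local Notation L := (n%:R * lambda : R).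

Definition idle (q : nat -> nat) : R := n%:R - (q 1%N)%:R.

Definition tail (i : nat) (q : nat -> nat) : R := (q i)%:R.

(* The number of customers in the first two levels, minus n. *)
Definition balance (q : nat -> nat) : R := tail 2 q - idle q.

(** The event that every server holds at least two customers, so that an arrival joins level 3 or
    higher. *)
Definition saturated (q : nat -> nat) : R := (q 2%N == n)%:R.

(** The last branch is 0 because an arrival to level 3 or higher leaves the first two levels
    unchanged. *)
Lemma jsq_generator12 (g : R -> R -> R) q : S q ->
  let x1 := tail 1 q in let x2 := tail 2 q in let x3 := tail 3 q in
  gen (fun q => g (tail 1 q) (tail 2 q)) q =
  L * (if (q 1 < n)%N then g (x1 + 1) x2 - g x1 x2
       else if (q 2 < n)%N then g x1 (x2 + 1) - g x1 x2 else 0) +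
  (x1 - x2) * (g (x1 - 1) x2 - g x1 x2) +
  (x2 - x3) * (g x1 (x2 - 1) - g x1 x2).
Proof.
move=> Sq x1 x2 x3; rewrite (jsq_generatorE n_gt0 (k := 3))//; last first.
  by move=> [|[|[|i]]]// _; rewrite /tail /sub_unit/= !subn0.
have [a1 qa qan] := arrival_indexP n_gt0 Sq.
have qle i := jsq_le i Sq.
rewrite -addrA; congr (_ * _ + _).
  case: ifPn => q1.
    rewrite -(arrival_index_uniq n_gt0 Sq (i := 1))//; last by case.
    by rewrite /tail /add_unit/= addn0 addn1 -natr1.
  have q1n : q 1%N = n by apply/eqP; rewrite eqn_leq qle leqNgt.
  case: ifPn => q2.
    rewrite -(arrival_index_uniq n_gt0 Sq (i := 2))//; last by case=> [|[]].
    by rewrite /tail /add_unit/= addn0 addn1 -natr1.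
  have q2n : q 2%N = n by apply/eqP; rewrite eqn_leq qle leqNgt.
  case: (arrival_index n q) a1 qan => [|[|[|a]]]//; rewrite ?q1n ?q2n ?ltnn// => _ _.
  by rewrite /tail /add_unit/= !addn0 subrr.
rewrite big_nat_recr//= big_nat1 /departure_rate /tail /sub_unit/= !subn0.
(* Truncated and real subtraction differ only at [q i = 0], where the departure rate vanishes. *)
have dec (c : R) (h : R -> R) i : (q i = 0%N -> c = 0) ->
    c * h (q i - 1)%N%:R = c * h ((q i)%:R - 1).
  case: (q i) => [->//|k _]; first by rewrite !mul0r.
  by rewrite subSS subn0 -natr1 addrK.
have qz i : q i = 0%N -> (q i)%:R - (q i.+1)%:R = 0 :> R.
  move=> qi; have [_ /(_ i) + _] := Sq; rewrite qi leqn0 => /eqP ->.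
  by rewrite subrr.
rewrite (dec _ (fun z => g z _ - _) 1%N (@qz _)).
by rewrite (dec _ (fun z => g _ z - _) 2%N (@qz _)).
Qed.

Lemma jsq_tail_bounds q : S q ->
  [/\ 0 <= tail 3 q, tail 3 q <= tail 2 q, tail 2 q <= tail 1 q & tail 1 q <= N].
Proof.
by move=> Sq; have [_ qS _] := Sq; rewrite /tail !ler_nat !qS (jsq_le 1 Sq) ler0n.
Qed.

Lemma jsq_idle_bounds q : S q ->
  [/\ 0 <= idle q, idle q <= N & tail 2 q <= N - idle q].
Proof.
move=> /jsq_tail_bounds[x30 x32 x21 x1N]; rewrite /idle -/(tail 1 q).
split; lra.
Qed.

Let L0 : 0 <= L. Proof. by rewrite mulr_ge0. Qed.
Let LN : L <= N. Proof. by rewrite ler_piMr. Qed.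
Let N1 : 1 <= N. Proof. by rewrite ler1n. Qed.

(** The three cases are those of the level that an arrival joins: first, second, or higher. *)
Variant jsq_state_spec q : Prop :=
| JsqIdle of (q 1 < n)%N & 1 <= idle q & saturated q = 0
| JsqBusy of (q 1 < n)%N = false & (q 2 < n)%N & idle q = 0 & saturated q = 0
| JsqFull of (q 1 < n)%N = false & (q 2 < n)%N = false & idle q = 0 &
    tail 2 q = N & saturated q = 1.

Lemma jsq_stateP q : S q -> jsq_state_spec q.
Proof.
move=> Sq; have [_ qS _] := Sq; have qle i := jsq_le i Sq.
have [q1|q1] := ltnP (q 1%N) n.
  apply: JsqIdle => //; last first.
    have q2 : (q 2 < n)%N by exact: leq_ltn_trans q1.
    by rewrite /saturated (ltn_eqF q2).
  by rewrite /idle -natrB ?ler1n ?subn_gt0// ltnW.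
have q1n : q 1%N = n by apply/eqP; rewrite eqn_leq qle.
have y0 : idle q = 0 by rewrite /idle q1n subrr.
have [q2|q2] := ltnP (q 2%N) n.
  by apply: JsqBusy => //; rewrite ?q1n ?ltnn// /saturated (ltn_eqF q2).
have q2n : q 2%N = n by apply/eqP; rewrite eqn_leq qle.
by apply: JsqFull => //; rewrite ?q1n ?q2n ?ltnn// /tail /saturated q2n ?eqxx.
Qed.

(** While positive, [idle] falls at rate [L] and rises at rate [N - idle q - tail 2 q]. The first
    terms are [idle] times its drift; the last comes from the total jump rate, at most [2 * N]. At
    [idle q = 0] only the rise remains. *)
Lemma drift_idle2 q : S q -> gen (fun q => idle q ^+ 2) q <=
  2 * ((N - L) * idle q - idle q ^+ 2 - idle q * tail 2 q + N).
Proof.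
move=> Sq; rewrite (jsq_generator12 (fun x _ => (N - x) ^+ 2))//.
have [x30 x32 x21 x1N] := jsq_tail_bounds Sq.
have -> : tail 1 q = N - idle q by rewrite /idle /tail subKr.
move: L0 LN N1 (jsq_idle_bounds Sq) => l0 lN n1 [y0 yN x2N].
case: (jsq_stateP Sq) => [-> y1 _|-> -> -> _|-> -> -> x2 _]; nra.
Qed.

(** [balance] rises by one at rate [L] unless [saturated], and falls by one at rate
    [tail 1 q - tail 3 q]. A term [- idle q ^+ 2] is dropped. *)
Lemma drift_balance2 q : S q -> gen (fun q => balance q ^+ 2) q <=
  2 * ((N - L) * idle q - (N - L) * tail 2 q + idle q * tail 2 q +
       N * (tail 3 q - L * saturated q) + N).
Proof.
move=> Sq; rewrite (jsq_generator12 (fun x z => (z - (N - x)) ^+ 2))//.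
have [x30 x32 x21 x1N] := jsq_tail_bounds Sq.
have -> : tail 1 q = N - idle q by rewrite /idle /tail subKr.
move: L0 LN N1 (jsq_idle_bounds Sq) => l0 lN n1 [y0 yN x2N].
case: (jsq_stateP Sq) => [-> y1 ->|-> -> -> ->|-> -> -> -> ->]; nra.
Qed.

(** This is [tail 2 q] times the bound of [drift_idle2]: level 2 grows only when [idle q = 0], where
    the function stays 0, and its decrease only lowers the drift. *)
Lemma drift_idle2_tail2 q : S q -> gen (fun q => idle q ^+ 2 * tail 2 q) q <=
  2 * ((N - L) * (idle q * tail 2 q) - idle q ^+ 2 * tail 2 q -
       idle q * tail 2 q ^+ 2 + N * tail 2 q).
Proof.
move=> Sq; rewrite (jsq_generator12 (fun x z => (N - x) ^+ 2 * z))//.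
have [x30 x32 x21 x1N] := jsq_tail_bounds Sq.
have -> : tail 1 q = N - idle q by rewrite /idle /tail subKr.
move: L0 LN N1 (jsq_idle_bounds Sq) => l0 lN n1 [y0 yN x2N].
case: (jsq_stateP Sq) => [-> y1 _|-> -> -> _|-> -> -> -> _]; nra.
Qed.

Lemma drift_idle3 q : S q -> gen (fun q => idle q ^+ 3) q <=
  3 * ((N - L) * idle q ^+ 2 - idle q ^+ 3 + 2 * N * idle q + N).
Proof.
move=> Sq; rewrite (jsq_generator12 (fun x _ => (N - x) ^+ 3))//.
have [x30 x32 x21 x1N] := jsq_tail_bounds Sq.
have -> : tail 1 q = N - idle q by rewrite /idle /tail subKr.
move: L0 LN N1 (jsq_idle_bounds Sq) => l0 lN n1 [y0 yN x2N].
case: (jsq_stateP Sq) => [-> y1 _|-> -> -> _|-> -> -> -> _]; nra.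
Qed.

Lemma drift_balance3 q : S q -> gen (fun q => balance q ^+ 3) q <=
  3 * (idle q * tail 2 q ^+ 2 + idle q ^+ 3 - (N - L) * balance q ^+ 2 +
       N ^+ 2 * (tail 3 q - L * saturated q) + 2 * N * tail 2 q + N).
Proof.
move=> Sq; rewrite (jsq_generator12 (fun x z => (z - (N - x)) ^+ 3))//.
have [x30 x32 x21 x1N] := jsq_tail_bounds Sq.
rewrite /balance; have -> : tail 1 q = N - idle q by rewrite /idle /tail subKr.
move: L0 LN N1 (jsq_idle_bounds Sq) => l0 lN n1 [y0 yN x2N].
(* [h1] drops the cross term of [idle q * balance q ^+ 2], [h2] replaces [balance q ^+ 2] by
   [N ^+ 2] in front of [tail 3 q], and [h3], [h4] bound the second-order term by a multiple of
   [N * tail 2 q]. *)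
have h1 : 0 <= tail 2 q * idle q ^+ 2 by rewrite mulr_ge0 ?exprn_ge0//; lra.
have h2 : 0 <= tail 3 q * ((N - balance q) * (N + balance q)).
  by rewrite mulr_ge0// mulr_ge0// /balance; lra.
have h3 : 0 <= tail 2 q * (N - L + idle q + tail 3 q) by rewrite mulr_ge0//; lra.
have h4 : 0 <= idle q * (L + N - idle q - tail 3 q) by rewrite mulr_ge0//; lra.
rewrite /balance in h2.
case: (jsq_stateP Sq) h1 h2 h3 h4 => [-> y1 ->|-> -> -> ->|-> -> -> -> ->] h1 h2 h3 h4.
- lra.
- lra.
- have : tail 3 q <= N * tail 3 q by rewrite ler_peMl.
  nra.
Qed.

End jsq_drift.

(** * Stationary moments *)

(** The sum counts customers at levels [m] to [k - 1]; the cutoff [k] keeps it bounded. Departure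
    rates telescope over these levels. *)
Lemma jsq_generator_tail_sum {R : realType} (n : nat) {lambda : R} (m k : nat)
    (q : nat -> nat) :
  (0 < n)%N -> jsq_space R n q -> (1 <= m <= k)%N ->
  generator (jsq_rate n lambda) (jsq_neighbours n)
    (fun q => \sum_(m <= i < k) @tail R i q) q =
  n%:R * lambda * (m <= arrival_index n q < k)%N%:R - @tail R m q + @tail R k q.
Proof.
move=> n_gt0 Sq /andP[m1 mk]; rewrite (jsq_generatorE n_gt0 (k := k))//; last first.
  move=> i ki; rewrite big_nat_cond [RHS]big_nat_cond.
  apply: eq_bigr => j /andP[/andP[_ jk] _].
  by rewrite /tail /sub_unit (ltn_eqF (leq_trans jk ki)) subn0.
rewrite -addrA; congr (_ * _ + _).
  rewrite -sumrB; set a := arrival_index n q.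
  rewrite (eq_bigr (fun i => if i == a then 1 else 0)); last first.
    by move=> i _; rewrite /tail /add_unit natrD addrAC subrr add0r; case: (i == a).
  by rewrite -big_mkcond big_nat1_eq; case: ifP.
rewrite (big_cat_nat m1 mk)/= [X in X + _]big1_seq ?add0r; last first.
  move=> i /andP[_]; rewrite mem_index_iota => /andP[_ im].
  rewrite -sumrB big1_seq ?mulr0// => j /andP[_].
  rewrite mem_index_iota => /andP[mj _].
  by rewrite /tail /sub_unit gtn_eqF ?subn0 ?subrr// (leq_trans im).
rewrite [LHS](_ : _ = \sum_(m <= i < k) (@tail R i.+1 q - @tail R i q)); last first.
  rewrite big_seq [RHS]big_seq; apply: eq_bigr => i; rewrite mem_index_iota => imk.
  rewrite -sumrB (eq_bigr (fun j =>
    if j == i then @tail R i (sub_unit i q) - @tail R i q else 0)); last first.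
    move=> j _; rewrite /tail /sub_unit; have [->|ji] := eqVneq j i.
      by rewrite !eqxx.
    by rewrite subn0 subrr.
  rewrite -big_mkcond big_nat1_eq imk /departure_rate /tail /sub_unit eqxx.
  have [_ /(_ i) qS _] := Sq.
  case: (q i) qS => [|c _]; last by rewrite subn1/= -[c.+1%:R]natr1; ring.
  by rewrite leqn0 => /eqP ->; rewrite !subrr mul0r.
by rewrite telescope_sumr// addrC.
Qed.

(** The variables stand for stationary moments, [s] for the square root of [n] and [u2] for the
    second moment of [balance]. The bounds have order [s] for [x2], [s ^+ 2] for [y2], [yx2], [u2],
    then [s ^+ 3] for [yx22], [y3], and finally 1 for [x3]. *)
Lemma moment_closure (R : realFieldType)
    (beta s y x2 x3 y2 yx2 yx22 y3 u2 x22 : R) :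
  0 < beta -> 1 <= s -> 0 <= y2 -> 0 <= yx2 ->
  y <= beta * s ->
  y2 + yx2 <= beta * s * y + s ^+ 2 ->
  beta * s * x2 <= beta * s * y + yx2 + s ^+ 2 ->
  yx22 <= beta * s * yx2 + s ^+ 2 * x2 ->
  y3 <= beta * s * y2 + 2 * s ^+ 2 * y + s ^+ 2 ->
  beta * s * u2 <= yx22 + y3 + 2 * s ^+ 2 * x2 + s ^+ 2 ->
  x22 <= u2 + 2 * yx2 ->
  s ^+ 2 * x3 <= x22 ->
  let b := beta ^+ 2 + 1 in
  let c := 2 * beta * b + 6 * b / beta + 2 * beta + 2 in
  x2 <= 2 * b / beta * s /\ x3 <= c / beta + 2 * b.
Proof.
move=> beta0 s1 y20 yx20 ly l2 lx2 lyx22 ly3 lu2 lx22 lx3 b c.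
have s0 : 0 < s by lra.
have bs0 : 0 < beta * s by rewrite mulr_gt0.
have b0 : 0 < b by rewrite /b ltr_wpDl ?sqr_ge0.
have s2 : 0 < s ^+ 2 by rewrite exprn_gt0.
have s23 : s ^+ 2 <= s ^+ 3 by rewrite [leRHS]exprSr ler_peMr// ltW.
have bsy : beta * s * y <= (beta * s) ^+ 2 by rewrite expr2 ler_wpM2l// ltW.
have y2b : y2 + yx2 <= b * s ^+ 2.
  by rewrite /b mulrDl mul1r -exprMn; lra.
have hx2 : x2 <= 2 * b / beta * s.
  rewrite -(ler_pM2l bs0) (_ : _ * (_ * s) = 2 * (b * s ^+ 2)); last first.
    by field; rewrite gt_eqF.
  apply: le_trans lx2 _.
  have : beta * s * y + s ^+ 2 <= b * s ^+ 2 by rewrite /b mulrDl mul1r -exprMn; lra.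
  lra.
split => //.
have hyx22 : yx22 <= (beta * b + 2 * b / beta) * s ^+ 3.
  apply: le_trans lyx22 _.
  have h1 : beta * s * yx2 <= beta * s * (b * s ^+ 2) by rewrite ler_pM2l//; lra.
  have h2 : s ^+ 2 * x2 <= s ^+ 2 * (2 * b / beta * s) by rewrite ler_pM2l.
  rewrite !exprS expr0 in h1 h2 *; lra.
have hy3 : y3 <= (beta * b + 2 * beta + 1) * s ^+ 3.
  apply: le_trans ly3 _.
  have h1 : beta * s * y2 <= beta * s * (b * s ^+ 2) by rewrite ler_pM2l//; lra.
  have h2 : s ^+ 2 * y <= s ^+ 2 * (beta * s) by rewrite ler_pM2l.
  rewrite !exprS expr0 in h1 h2 s23 *; lra.
(* [c] adds up the coefficients of [s ^+ 3] in the bounds for [yx22], [y3] and [2 * s ^+ 2 * x2],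
   plus 1 for the leftover [s ^+ 2]. *)
have hu2 : u2 <= c / beta * s ^+ 2.
  rewrite -(ler_pM2l bs0) (_ : _ * (_ * s ^+ 2) = c * s ^+ 3); last first.
    by field; rewrite gt_eqF.
  apply: le_trans lu2 _.
  have h2 : s ^+ 2 * x2 <= s ^+ 2 * (2 * b / beta * s) by rewrite ler_pM2l.
  rewrite /c !exprS expr0 in h2 hyx22 hy3 s23 *; lra.
rewrite -(ler_pM2l s2); apply: le_trans lx3 _; apply: le_trans lx22 _.
lra.
Qed.

(** * Moment inequalities under the stationary law *)

Section jsq_stationary.
Context {R : realType} (n : nat) {lambda : R}.
Hypothesis n_gt0 : (0 < n)%N.
Hypothesis lambda_ge0 : 0 <= lambda.
Hypothesis lambda_le1 : lambda <= 1.
Local Notation S := (jsq_space R n).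
Local Notation gen := (generator (jsq_rate n lambda) (jsq_neighbours n)).
Local Notation N := (n%:R : R).
Local Notation L := (n%:R * lambda : R).
Context {P : R -> (nat -> nat) -> (nat -> nat) -> R}.
Hypothesis chainP : markov_chain_with_rates S (jsq_rate n lambda) P.
Context {d : measure_display} {T : measurableType d} {Pr : probability T R}
  {Z : T -> nat -> nat}.
Hypothesis ZS : forall w, S (Z w).
Hypothesis Zm : forall q, measurable [set w | Z w = q].
Hypothesis invP : invariant_law S P (fun q => Pr [set w | Z w = q]).
Local Notation "''E' g" := (expect Pr Z g) (at level 10, g at level 8).
Local Notation x2 := (@tail R 2).
Local Notation x3 := (@tail R 3).
Local Notation y := (idle n).
Local Notation U := (balance n).
Let Scount := @countable_jsq_space R n.

Lemma bounded_on_tail i : bounded_on S (@tail R i).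
Proof. by exists N => q Sq; rewrite /tail ger0_norm// ler_nat (jsq_le _ Sq). Qed.

Lemma bounded_on_idle : bounded_on S (@idle R n).
Proof.
by apply: bounded_onB; [exact: bounded_on_cst|exact: (bounded_on_tail 1)].
Qed.

Lemma bounded_on_balance : bounded_on S (@balance R n).
Proof. by apply: bounded_onB; [exact: bounded_on_tail|exact: bounded_on_idle]. Qed.

Lemma bounded_on_saturated : bounded_on S (@saturated R n).
Proof.
by exists 1 => q _; rewrite /saturated; case: eqP => _; rewrite ?normr1 ?normr0.
Qed.

Local Ltac bounded := repeat first
  [ assumption | exact: bounded_on_cst | exact: bounded_on_tail
  | exact: bounded_on_idle
  | exact: bounded_on_balance | exact: bounded_on_saturated
  | apply: bounded_onX | apply: bounded_onM | apply: bounded_onB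
  | apply: bounded_onD | apply: bounded_on_sum => ? ].

Lemma expect_jsq_generator (f : (nat -> nat) -> R) : bounded_on S f ->
  bounded_on S (gen f) /\ 'E (gen f) = 0.
Proof.
move=> bf.
have K q (Sq : S q) := jsq_rate_le (lambda := lambda) n_gt0 Sq.
have NS q q' : S q -> q' \in jsq_neighbours n q -> S q'.
  by move=> Sq; exact: jsq_neighbours_sub.
have r0 q q' : S q -> S q' -> q' != q -> 0 <= jsq_rate n lambda q q'.
  by move=> Sq _ _; exact: jsq_rate_ge0.
have rz q q' : S q -> S q' -> q' != q -> q' \notin jsq_neighbours n q ->
    jsq_rate n lambda q q' = 0.
  by move=> Sq _ _; exact: jsq_rate_eq0.
have Nu q : S q -> uniq (jsq_neighbours n q).
  by move=> _; exact: jsq_neighbours_uniq.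
have Ni q : S q -> q \notin jsq_neighbours n q.
  by move=> _; exact: jsq_neighbours_irr.
split; first exact: (bounded_on_generator NS Ni r0 K).
exact: (expect_generator chainP Nu NS Ni r0 rz K Scount ZS Zm invP bf).
Qed.

(** Since [gen f] has mean zero, any bounded upper bound of the drift has nonnegative mean. *)
Lemma expect_drift_ge0 (f g : (nat -> nat) -> R) :
  (forall q, S q -> gen f q <= g q) -> bounded_on S f -> bounded_on S g ->
  0 <= 'E g.
Proof.
move=> fg bf bg; have [bGf <-] := expect_jsq_generator bf.
exact: (expect_le Scount ZS Zm).
Qed.

(** This removes the truncation at level [k] from the linear test functions. *)
Lemma expect_tail_cvg0 : 'E (@tail R k) @[k --> \oo] --> (0 : R).
Proof.
have bt k q : S q -> `|@tail R k q| <= N.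
  by move=> Sq; rewrite /tail ger0_norm// ler_nat (jsq_le _ Sq).
rewrite -[X in _ --> X](expect_cst (Pr := Pr) (Z := Z)).
apply: (expect_cvg Scount ZS Zm bt) => q Sq.
apply: cvg_near_cst; near=> k.
rewrite /tail (support_boundP Sq)//; near: k; exact: nbhs_infty_ge.
Unshelve. all: by end_near. Qed.

(* Generalizing first prevents unification from expanding [idle] and [balance]. *)
Local Ltac linear :=
  move: (@idle R n) bounded_on_idle (@balance R n) bounded_on_balance => ? ? ? ?;
  rewrite !(expectB Scount ZS Zm, expectD Scount ZS Zm, expectZ Scount ZS Zm,
    expect_cst); try by bounded.

(** Balance of flow for the number of customers at levels 1 to [k], followed by [k] tending to
    infinity. *)
Lemma expect_idle_le : 'E y <= N - L.
Proof.
have h : lambda * 'E (tail k) @[k --> \oo] --> lambda * 0.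
  by apply: cvgMr; exact: expect_tail_cvg0.
rewrite -subr_le0 -[leRHS](mulr0 lambda) -(cvg_lim _ h)//.
apply: limr_ge; first exact: cvgP h.
near=> k; have k0 : (0 < k)%N by near: k; exact: nbhs_infty_gt.
pose f (q : nat -> nat) : R := \sum_(1 <= i < k.+1) tail i q.
have bf : bounded_on S f by bounded.
have [bGf Gf0] := expect_jsq_generator bf.
have : 'E (fun q => y q - (N - L) - lambda * tail k q) <= 'E (gen f).
  apply: (expect_le Scount ZS Zm) => //; first by bounded.
  move=> q Sq; rewrite (jsq_generator_tail_sum n_gt0 Sq)//.
  have [a1 qa _] := arrival_indexP n_gt0 Sq.
  have t0 : 0 <= tail k.+1 q :> R by exact: ler0n.
  have t0' : 0 <= lambda * tail k q by rewrite mulr_ge0// ler0n.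
  rewrite a1 ltnS /idle -/(tail 1 q); case: leqP => /= [_|ka]; first by lra.
  (* An arrival above level [k] means that level [k] is full, so the missing rate [L] equals
     [lambda * tail k q]. *)
  have -> : tail k q = N by rewrite /tail qa// k0.
  by lra.
rewrite Gf0; linear; lra.
Unshelve. all: by end_near. Qed.

(** Balance of flow for the levels from 3 on: an arrival reaches them only when level 2 is full. *)
Lemma expect_tail3_le : 'E x3 <= L * 'E (@saturated R n).
Proof.
have h : 'E (tail k) @[k --> \oo] --> (0 : R) := expect_tail_cvg0.
rewrite -subr_le0 -(cvg_lim _ h)//.
apply: limr_ge; first exact: cvgP h.
near=> k; have k3 : (3 <= k)%N by near: k; exact: nbhs_infty_ge.
have drift q : S q -> gen (fun q => \sum_(3 <= i < k) tail i q) q <=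
    L * saturated n q - x3 q + tail k q.
  move=> Sq; rewrite (jsq_generator_tail_sum n_gt0 Sq) ?k3// lerD2r lerD2r.
  rewrite ler_wpM2l ?mulr_ge0// /saturated ler_nat.
  have [_ qa _] := arrival_indexP n_gt0 Sq.
  by case: ltnP => // a3; rewrite qa ?eqxx//; case: (_ < _)%N.
have := expect_drift_ge0 drift ltac:(bounded) ltac:(bounded).
linear; lra.
Unshelve. all: by end_near. Qed.

Lemma expect_saturated_drift :
  'E (fun q => x3 q - L * saturated n q) <= 0.
Proof. by have := expect_tail3_le; linear; rewrite subr_le0. Qed.

Lemma expect_idle2 : 'E (fun q => y q ^+ 2) + 'E (fun q => y q * x2 q) <=
  (N - L) * 'E y + N.
Proof.
have := expect_drift_ge0
  (fun q Sq => drift_idle2 n_gt0 lambda_ge0 lambda_le1 Sq)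
  ltac:(bounded) ltac:(bounded).
linear; lra.
Qed.

Lemma expect_balance2 : (N - L) * 'E x2 <=
  (N - L) * 'E y + 'E (fun q => y q * x2 q) + N.
Proof.
have := expect_drift_ge0
  (fun q Sq => drift_balance2 n_gt0 lambda_ge0 lambda_le1 Sq)
  ltac:(bounded) ltac:(bounded).
have := mulr_ge0_le0 (ler0n R n) expect_saturated_drift.
linear; lra.
Qed.

Lemma expect_idle2_tail2 : 'E (fun q => y q * x2 q ^+ 2) <=
  (N - L) * 'E (fun q => y q * x2 q) + N * 'E x2.
Proof.
have y2x2 : 0 <= 'E (fun q => y q ^+ 2 * x2 q).
  by apply: Rintegral_ge0 => w _; rewrite mulr_ge0 ?sqr_ge0// ler0n.
have := expect_drift_ge0
  (fun q Sq => drift_idle2_tail2 n_gt0 lambda_ge0 lambda_le1 Sq)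
  ltac:(bounded) ltac:(bounded).
move: y2x2; linear; lra.
Qed.

Lemma expect_idle3 : 'E (fun q => y q ^+ 3) <=
  (N - L) * 'E (fun q => y q ^+ 2) + 2 * N * 'E y + N.
Proof.
have := expect_drift_ge0
  (fun q Sq => drift_idle3 n_gt0 lambda_ge0 lambda_le1 Sq)
  ltac:(bounded) ltac:(bounded).
linear; lra.
Qed.

Lemma expect_balance3 : (N - L) * 'E (fun q => U q ^+ 2) <=
  'E (fun q => y q * x2 q ^+ 2) + 'E (fun q => y q ^+ 3) + 2 * N * 'E x2 + N.
Proof.
have := expect_drift_ge0
  (fun q Sq => drift_balance3 n_gt0 lambda_ge0 lambda_le1 Sq)
  ltac:(bounded) ltac:(bounded).
have := mulr_ge0_le0 (exprn_ge0 2 (ler0n R n)) expect_saturated_drift.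
linear; lra.
Qed.

(** As [U = x2 - y], the difference of the two integrands is [y ^+ 2]. *)
Lemma expect_tail2_sqr : 'E (fun q => x2 q ^+ 2) <=
  'E (fun q => U q ^+ 2) + 2 * 'E (fun q => y q * x2 q).
Proof.
have : 'E (fun q => x2 q ^+ 2) <= 'E (fun q => U q ^+ 2 + 2 * (y q * x2 q)).
  apply: (expect_le Scount ZS Zm); [by bounded..|].
  move=> q Sq; rewrite /balance -subr_ge0.
  by rewrite (_ : _ - _ = y q ^+ 2) ?sqr_ge0//; ring.
linear; lra.
Qed.

(* Markov's inequality for the event x2 = n. *)
Lemma expect_tail3_markov : N * 'E x3 <= 'E (fun q => x2 q ^+ 2).
Proof.
have : 'E (fun q => N * (N * saturated n q)) <= 'E (fun q => x2 q ^+ 2).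
  apply: (expect_le Scount ZS Zm); [by bounded..|].
  move=> q Sq; rewrite /saturated /tail; case: eqP => [->|_].
    by rewrite mulr1 -expr2.
  by rewrite !mulr0 sqr_ge0.
have s0 : 0 <= 'E (@saturated R n).
  by apply: Rintegral_ge0 => w _; exact: ler0n.
have LN : L <= N by rewrite ler_piMr.
have := ler_wpM2l (ler0n R n) expect_tail3_le.
have := ler_wpM2l (ler0n R n) (ler_wpM2r s0 LN).
linear; lra.
Qed.

(** The Halfin-Whitt scaling enters through [N - L = beta * s], which turns the stationary
    inequalities into the hypotheses of [moment_closure]. *)
Lemma jsq_moment_bounds (beta s : R) : 0 < beta -> 1 <= s ->
  N = s ^+ 2 -> N - L = beta * s ->
  let b := beta ^+ 2 + 1 in
  let c := 2 * beta * b + 6 * b / beta + 2 * beta + 2 in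
  [/\ 'E y <= beta * s, 'E x2 <= 2 * b / beta * s & 'E x3 <= c / beta + 2 * b].
Proof.
move=> beta0 s1 NE NL b c.
have y2 : 0 <= 'E (fun q => y q ^+ 2).
  by apply: Rintegral_ge0 => w _; exact: sqr_ge0.
have yx2 : 0 <= 'E (fun q => y q * x2 q).
  apply: Rintegral_ge0 => w _; rewrite mulr_ge0 ?ler0n//.
  by have [] := jsq_idle_bounds (ZS w).
have h1 := expect_idle_le; have h2 := expect_idle2; have h3 := expect_balance2.
have h4 := expect_idle2_tail2; have h5 := expect_idle3; have h6 := expect_balance3.
have h7 := expect_tail2_sqr; have h8 := expect_tail3_markov.
rewrite NL in h1 h2 h3 h4 h5 h6; rewrite NE in h2 h3 h4 h5 h6 h8.
by have [] := moment_closure beta0 s1 y2 yx2 h1 h2 h3 h4 h5 h6 h7 h8.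
Qed.

End jsq_stationary.

(** * Uniform moment bounds in the Halfin-Whitt scaling *)

Theorem theorem2 (R : realType) (beta : R) (beta_gt0 : 0 < beta) :
  exists C : R,
  forall (n : nat) (lambda : R),
    (1 <= n)%N -> lambda = 1 - beta / Num.sqrt n%:R -> 0 < lambda ->
  forall P : R -> (nat -> nat) -> (nat -> nat) -> R,
    markov_chain_with_rates (jsq_space R n) (jsq_rate n lambda) P ->
  forall (d : measure_display) (T : measurableType d) (Pr : probability T R)
    (Q : nat -> {RV Pr >-> nat}),
    (forall w, jsq_space R n (fun i => Q i w)) ->
    invariant_law (jsq_space R n) P
      (fun q => Pr [set w | (fun i => Q i w) = q]) ->
  (forall i : nat, i = 1%N \/ i = 2%N ->
     ('E_Pr [fun w => `|Num.sqrt n%:R * jsq_fluid R n (fun j => Q j w) i|%R]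
       <= C%:E)%E) /\
  (forall i : nat, (3 <= i)%N ->
     ('E_Pr [fun w => `|n%:R * jsq_fluid R n (fun j => Q j w) i|%R]
       <= C%:E)%E).
Proof.
pose b := beta ^+ 2 + 1.
pose c := 2 * beta * b + 6 * b / beta + 2 * beta + 2.
have b0 : 0 < b by rewrite /b ltr_wpDl ?sqr_ge0.
have p0 : 0 <= 2 * b / beta by rewrite divr_ge0 ?mulr_ge0// ltW.
have c0 : 0 <= c / beta.
  by rewrite divr_ge0 ?(ltW beta_gt0)// /c !addr_ge0 ?divr_ge0 ?mulr_ge0// ltW.
(* The sum of the nonnegative bounds for level 1, level 2 and all higher levels, so one constant
   serves them all. *)
exists (beta + 2 * b / beta + (c / beta + 2 * b)).
move=> n lambda n_gt0 lambdaE lambda_gt0 P chainP d T Pr Q QS invP.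
have lambda_ge0 := ltW lambda_gt0.
set s : R := Num.sqrt n%:R in lambdaE *.
have s2 : n%:R = s ^+ 2 by rewrite sqr_sqrtr.
have s1 : 1 <= s by rewrite -sqrtr1 ler_wsqrtr// ler1n.
have s0 : 0 < s by rewrite (lt_le_trans ltr01).
have lambda_le1 : lambda <= 1 by rewrite lambdaE gerBl divr_ge0// ltW.
have NL : n%:R - n%:R * lambda = beta * s.
  by rewrite lambdaE s2; field; rewrite gt_eqF.
pose Z w : nat -> nat := fun i => Q i w.
have Zm q : measurable [set w | Z w = q].
  rewrite (_ : [set w | _] = \bigcap_i (Q i @^-1` [set q i])).
    apply: bigcap_measurable => [|i _]; first by exists 0%N.
    by rewrite -[X in measurable X]setTI; exact: measurable_funP.
  apply/seteqP; split => [w <- i _//|w Qq].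
  by apply/funext => i; exact: (Qq i I).
have Scount := @countable_jsq_space R n.
have [Ey Ex2 Ex3] := jsq_moment_bounds n_gt0 lambda_ge0 lambda_le1 chainP QS Zm
  invP beta_gt0 s1 s2 NL.
have n0 : n%:R != 0 :> R by rewrite pnatr_eq0 -lt0n.
(* Common form of the three cases: [e] is [s] for levels 1 and 2, and 1 for the higher levels. *)
have scaled (e : R) (g h : (nat -> nat) -> R) (C : R) : 0 < e ->
    bounded_on (jsq_space R n) g -> expect Pr Z g <= C * e ->
    (forall q, jsq_space R n q -> `|h q| = e^-1 * g q) ->
    ('E_Pr[fun w => `|h (Z w)|%R] <= C%:E)%E.
  move=> e0 bg Eg hE; rewrite unlock.
  rewrite (eq_integral (fun w => (e^-1 * g (Z w))%:E)); last first.
    by move=> w _; rewrite hE//; exact: QS.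
  have beg : bounded_on (jsq_space R n) (fun q => e^-1 * g q).
    by apply: bounded_onM => //; exact: bounded_on_cst.
  rewrite (EFin_expect Scount QS Zm beg) (expectZ Scount QS Zm)// lee_fin.
  by rewrite mulrC ler_pdivrMr.
have sE z : s * (z / n%:R) = s^-1 * z by rewrite s2; field; rewrite gt_eqF.
have b2 : 0 <= 2 * b by rewrite mulr_ge0// ltW.
split => [i [] ->|i i3].
- apply: (scaled s (idle n) (fun q => s * jsq_fluid R n q 1)) => //.
  + exact: bounded_on_idle.
  + by apply: le_trans Ey _; rewrite ler_pM2r// -addrA lerDl !addr_ge0.
  + move=> q /jsq_idle_bounds[y0 _ _]; rewrite /jsq_fluid/= sE normrM.
    by rewrite gtr0_norm ?invr_gt0// distrC ger0_norm.
- apply: (scaled s (tail 2) (fun q => s * jsq_fluid R n q 2)) => //.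
  + exact: bounded_on_tail.
  + apply: le_trans Ex2 _; rewrite ler_pM2r// -/b.
    by rewrite addrAC lerDr !addr_ge0// ltW.
  + by move=> q _; rewrite /jsq_fluid/= sE ger0_norm// mulr_ge0// invr_ge0 ltW.
- apply: (scaled 1 (tail i) (fun q => n%:R * jsq_fluid R n q i)) => //.
  + exact: bounded_on_tail.
  (* By monotonicity of the state, level 3 controls all higher levels. *)
  + apply: (@le_trans _ _ (expect Pr Z (tail 3))).
      apply: (expect_le Scount QS Zm); [exact: bounded_on_tail..|].
      by move=> q Sq; rewrite ler_nat (jsq_nonincr Sq).
    by rewrite mulr1; apply: le_trans Ex3 _; rewrite -/b -/c lerDr addr_ge0// ltW.
  + move=> q _; rewrite /jsq_fluid gtn_eqF ?(ltnW i3)// invr1 mul1r.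
    by rewrite mulrCA divff// mulr1 ger0_norm.
Qed.
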